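(* For the online Submodular Welfare Maximization problem in the random order model in which every agent's valuation function is second-order supermodular, the Greedy algorithm has competitive ratio at least $0.5104$.
   Context: Online SWM: a set $N$ of $n$ items and $m$ agents; agent $\ell$ has a monotone submodular valuation $v_\ell:2^N\to\mathbb{R}_{\ge0}$ with $v_\ell(\emptyset)=0$. Items arrive one at a time in a uniformly random order and each must be irrevocably assigned to an agent upon arrival; welfare is $\sum_\ell v_\ell(S_\ell)$ and $\mathrm{OPT}$ is the maximum welfare of a partition of $N$. Greedy assigns each arriving item $j$ to an agent maximizing $v_\ell(S_\ell\cup\{j\})-v_\ell(S_\ell)$ with $S_\ell$ the current set of $\ell$. Competitive ratio: infimum over instances of $\mathbb{E}[\text{Greedy welfare}]/\mathrm{OPT}$. For a set function $f$, let $MG(A,e)=f(A\cup\{e\})-f(A)$. A submodular $f$ is second-order supermodular if for all sets $A\subseteq B$, all $S$ with $S\cap B=\emptyset$, and all elements $e$: $MG(A,e)-MG(A\cup S,e)\ \ge\ MG(B,e)-MG(B\cup S,e)$. *)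

(* Defs.v *)
From HB Require Import structures.
From mathcomp Require Import all_boot all_order all_algebra all_fingroup.
From mathcomp Require Import boolp classical_sets reals.

Set Implicit Arguments.
Unset Strict Implicit.
Unset Printing Implicit Defensive.

Import Order.TTheory GRing.Theory Num.Theory.

Local Open Scope ring_scope.

Section SetFunctions.
Context {R : realType} {N : finType}.
Implicit Types (f : {set N} -> R) (A B S : {set N}) (e : N).

Definition MG f A e : R := f (e |: A) - f A.

Definition monotone f := forall A B, A \subset B -> f A <= f B.

Definition submodular f :=
  forall A B, f (A :|: B) + f (A :&: B) <= f A + f B.

Definition valuation f :=
  [/\ forall A, 0 <= f A, f finset.set0 = 0, monotone f & submodular f].

(* Only ever used for an f that is also a [valuation], hence submodular. *)
Definition second_order_supermodular f :=
  forall A B S e, A \subset B -> [disjoint S & B] ->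
    MG f B e - MG f (B :|: S) e <= MG f A e - MG f (A :|: S) e.

End SetFunctions.

Section Welfare.
Context {R : realType} {N M : finType}.
Variable v : M -> {set N} -> R.

Definition welfare (S : M -> {set N}) : R := \sum_l v l (S l).

(* A partition of N into one, possibly empty, bundle per agent is given by the
   function sending each item to its agent.  The default value 0 is harmless,
   valuations being nonnegative. *)
Definition OPT : R :=
  \big[Num.max/0]_(a : {ffun N -> M}) welfare (fun l => [set j | a j == l]).

(* A deterministic online assignment rule: [alg h j] is the agent who receives
   the arriving item j when h is the list of earlier items, in order of
   arrival.  Earlier decisions are determined by the prefixes of h. *)
Definition online_rule := seq N -> N -> M.

Definition bundle (alg : online_rule) (s : seq N) (l : M) : {set N} :=
  [set j in s | alg (take (index j s) s) j == l].

(* Ties may be broken arbitrarily, even depending on the whole history. *)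
Definition greedy (alg : online_rule) :=
  forall (h : seq N) (j : N), uniq (rcons h j) ->
    forall l : M, MG (v l) (bundle alg h l) j
                  <= MG (v (alg h j)) (bundle alg h (alg h j)) j.

Definition expected_welfare (alg : online_rule) : R :=
  (\sum_(s : {perm N}) welfare (bundle alg [seq s i | i <- enum N]))
    / #|{perm N}|%:R.

End Welfare.

(* The infimum of E[Greedy]/OPT over the instances whose valuations lie in the
   class C, and over all tie-breaking rules.  Instances with OPT = 0, for which
   the ratio is undefined, are left out. *)
Definition greedy_competitive_ratio (R : realType)
    (C : forall N : finType, ({set N} -> R) -> Prop) : R :=
  inf (fun r : R => exists (N M : finType) (v : M -> {set N} -> R)
                           (alg : online_rule),
    [/\ forall l, valuation (v l) /\ C N (v l),
        greedy v alg,
        0 < OPT v &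
        r = expected_welfare v alg / OPT v]).

(* Main.v *)
Require Import Defs.
From mathcomp Require Import all_boot all_order all_algebra all_fingroup.
From mathcomp Require Import reals.
From mathcomp Require Import zify lra.

(**
Identify an allocation with its set of (item, agent) pairs, so that the welfare
is a single monotone submodular second-order supermodular function f of sets of
pairs.  Fix an allocation o of the n items.  For a random order let g_p be the
mean of f over the first p choices of Greedy, x_p the mean marginal over these
choices of the pair o gives to an item that has not yet arrived, and
X_p = x_0 + ... + x_{p-1}.  Greedy gives g_{p+1} - g_p >= x_p, x is decreasing,
and submodularity gives f(o) <= g_p + X_p + (n - p) x_p, hence
g_p + X_p >= (1 - (1 - p/n)^2) f(o).  This only yields g_n >= f(o)/2, and
equality would force the items arriving after j not to damage the marginal of
the pair o gives to j any more.

Second-order supermodularity excludes this.  Split a random order as K J with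
|J| = n/4, run Greedy on K, and cut its choices into C_0, C_1, C_2 according to
the position modulo 3.  For each r the order made of J, then K without the
residue class r in reverse, then the residue class r, is again uniform; in it
the items of the class arrive last, so they gain little, and therefore f(C_r | A),
where A is the outcome of that order, is at most g_n - g_{3n/4} on average.  Thus
C_r damages little the items that arrived early.  But the damage to a pair over a
fixed set is subadditive in the damaging set, so the damages of C_0, C_1 and C_2
add up to at least that of the whole run on K, which is large.  Summing the three
inequalities and using the bounds on g + X at a few points gives
g_n >= 0.5106 f(o) in the limit; adding worthless items makes n as large (and as
divisible) as needed.
*)

Set Implicit Arguments.
Unset Strict Implicit.
Unset Printing Implicit Defensive.

Import Order.TTheory GRing.Theory Num.Theory.

Local Open Scope ring_scope.

Section Marginals.
Context {R : realType} {T : finType} {f : {set T} -> R}.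
Implicit Types (A B C D Y : {set T}) (e : T).

Definition damage Y C e : R := MG f Y e - MG f (Y :|: C) e.

Lemma MG_mem A e : e \in A -> MG f A e = 0.
Proof. by move=> eA; rewrite /MG (setUidPr _) ?sub1set ?subrr. Qed.

Hypothesis f_val : valuation f.

Lemma valuation_ge0 A : 0 <= f A.
Proof. by case: f_val. Qed.

Lemma valuation_set0 : f finset.set0 = 0.
Proof. by case: f_val. Qed.

Lemma valuation_le A B : A \subset B -> f A <= f B.
Proof. by case: f_val => _ _ f_mono _; apply: f_mono. Qed.

Lemma MG_ge0 A e : 0 <= MG f A e.
Proof. by rewrite subr_ge0 valuation_le ?subsetUr. Qed.

Lemma MG_anti A B e : A \subset B -> MG f B e <= MG f A e.
Proof.
move=> sAB; have [eB|eB] := boolP (e \in B); first by rewrite MG_mem ?MG_ge0.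
case: f_val => _ _ _ /(_ (e |: A) B).
rewrite -setUA (setUidPr sAB) setIUl (setIidPl sAB).
have -> : [set e] :&: B = finset.set0 by apply/disjoint_setI0; rewrite disjoints1.
by rewrite set0U /MG; lra.
Qed.

Lemma valuation_setU_le A (cs : seq T) :
  f (A :|: [set:: cs]) <= f A + \sum_(c <- cs) MG f A c.
Proof.
elim: cs => [|c cs IH]; first by rewrite set_nil setU0 big_nil addr0.
rewrite big_cons set_cons setUCA.
have := @MG_anti A (A :|: [set:: cs]) c (subsetUl _ _).
by rewrite {1}/MG; lra.
Qed.

Hypothesis f_sos : second_order_supermodular f.

Lemma damageU Y C D e : damage Y (C :|: D) e <= damage Y C e + damage Y D e.
Proof.
pose D' := D :\: (Y :|: C).
have disjD' : [disjoint D' & Y :|: C].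
  by rewrite -setI_eq0 setIDAC setDE -setIA setICr setI0.
have YCD' : Y :|: C :|: D' = Y :|: (C :|: D).
  by apply/setP => z; rewrite !inE; do !case: (z \in _).
have := f_sos e (subsetUl Y C) disjD'; rewrite YCD'.
have := MG_anti e (setUS Y (subsetDl D (Y :|: C))).
by rewrite /damage; lra.
Qed.

Lemma damage_bigcup (I : Type) (r : seq I) (P : pred I) (C : I -> {set T}) Y e :
  damage Y (\bigcup_(i <- r | P i) C i) e <= \sum_(i <- r | P i) damage Y (C i) e.
Proof.
elim/big_rec2: _ => [|i S U _ IH]; first by rewrite /damage setU0 subrr.
by apply: le_trans (damageU _ _ _ _) _; rewrite lerD2l.
Qed.

End Marginals.

Section SumsAndPreimages.
Context {R : realType}.

Lemma MG_sum (T L : finType) (f : L -> {set T} -> R) A e :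
  MG (fun S => \sum_l f l S) A e = \sum_l MG (f l) A e.
Proof. by rewrite /MG sumrB. Qed.

Lemma valuation_sum (T L : finType) (f : L -> {set T} -> R) :
  (forall l, valuation (f l)) -> valuation (fun S => \sum_l f l S).
Proof.
move=> f_val; split.
- by move=> S; apply: sumr_ge0 => l _; apply: valuation_ge0.
- by apply: big1 => l _; apply: valuation_set0.
- by move=> A B sAB; apply: ler_sum => l _; apply: valuation_le.
- move=> A B; rewrite -!big_split; apply: ler_sum => l _ /=.
  by case: (f_val l) => _ _ _; apply.
Qed.

Lemma second_order_supermodular_sum (T L : finType) (f : L -> {set T} -> R) :
  (forall l, second_order_supermodular (f l)) ->
  second_order_supermodular (fun S => \sum_l f l S).
Proof.
move=> f_sos A B S e sAB dSB; rewrite !MG_sum -!sumrB.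
by apply: ler_sum => l _; apply: f_sos.
Qed.

Context {T T' : finType} (h : T -> T') (f : {set T} -> R).

Lemma valuation_preim : valuation f -> valuation (fun S => f (h @^-1: S)).
Proof.
move=> f_val; split.
- by move=> S; apply: valuation_ge0.
- by rewrite preimset0 valuation_set0.
- by move=> A B sAB; apply/valuation_le/preimsetS.
- by move=> A B; rewrite preimsetU preimsetI; case: f_val.
Qed.

Lemma MG_preim_notin S e :
  (forall j, h j != e) -> MG (fun S => f (h @^-1: S)) S e = 0.
Proof.
move=> he; rewrite /MG preimsetU (_ : h @^-1: [set e] = finset.set0) ?set0U ?subrr //.
by apply/setP => j; rewrite !inE (negPf (he j)).
Qed.

Hypothesis h_inj : injective h.

Lemma MG_preim S j : MG (fun S => f (h @^-1: S)) S (h j) = MG f (h @^-1: S) j.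
Proof.
rewrite /MG preimsetU (_ : h @^-1: [set h j] = [set j]) //.
by apply/setP => i; rewrite !inE (inj_eq h_inj).
Qed.

Lemma second_order_supermodular_preim :
  second_order_supermodular f ->
  second_order_supermodular (fun S => f (h @^-1: S)).
Proof.
move=> f_sos A B S e sAB dSB.
case: (pickP (fun j => h j == e)) => [j /eqP <-|he]; last first.
  by rewrite !MG_preim_notin // => j; rewrite he.
rewrite !MG_preim !preimsetU; apply: f_sos; first exact: preimsetS.
by move: dSB; rewrite -!setI_eq0 -preimsetI => /eqP ->; rewrite preimset0.
Qed.

End SumsAndPreimages.

Section Cardinality.
Context {R : realType} {T : finType}.

Lemma valuation_card : valuation (fun A : {set T} => #|A|%:R : R).
Proof.
split; rewrite ?cards0 //.
- by move=> A B sAB; rewrite ler_nat subset_leq_card.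
- by move=> A B; rewrite -!natrD cardsUI.
Qed.

Lemma second_order_supermodular_card :
  second_order_supermodular (fun A : {set T} => #|A|%:R : R).
Proof.
move=> A B S e sAB dSB.
have MG_card C : MG (fun A : {set T} => #|A|%:R : R) C e = (e \notin C)%:R.
  by rewrite /MG cardsU1 natrD addrK.
rewrite !MG_card !inE; have [eS|eS] := boolP (e \in S); last by rewrite !orbF !subrr.
have eB := disjointFr dSB eS.
by rewrite eB (contraFF (subsetP sAB e) eB).
Qed.

End Cardinality.

Lemma bin2_sqr_le m n : (m <= n)%N -> ('C(m, 2) * n ^ 2 <= 'C(n, 2) * m ^ 2)%N.
Proof.
have bin2D k : ('C(k, 2) * 2 = k * k.-1)%N.
  by rewrite mulnC mul_bin_left bin1 subn1 mulnC.
move=> mn; rewrite -(leq_pmul2r (isT : 0 < 2)%N) !(mulnAC _ _ 2) !bin2D.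
have pred_le : (m.-1 * n <= n.-1 * m)%N by case: m n mn => [|m] [|n] //=; lia.
by have := leq_mul (leqnn (m * n)) pred_le; lia.
Qed.

Lemma quadratic_decay (R : realFieldType) (n : nat) (u x : nat -> R) :
  (forall p, (p < n)%N -> 0 <= x p) ->
  (forall p, (p < n)%N -> u p <= (n - p)%:R * x p) ->
  (forall p, (p < n)%N -> u p.+1 <= u p - 2 * x p) ->
  forall p, (p <= n)%N -> u p * 'C(n, 2)%:R <= u 0 * 'C(n - p, 2)%:R.
Proof.
move=> x_ge0 u_le u_step; elim=> [|p IH] pn; first by rewrite subn0.
have {}IH := IH (ltnW pn).
have := u_le p pn; have := u_step p pn; have := x_ge0 p pn.
have := mul_bin_down (n - p) 2.
have : (0 < n - p)%N by rewrite subn_gt0.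
rewrite [(n - p.+1)%N]subnS; move: (n - p)%N IH => m IH m_gt0 binm.
move=> xp_ge0 up_step up_le.
have decay : m%:R * u p.+1 <= (m - 2)%:R * u p.
  case: m m_gt0 {IH binm} up_le => [//|[|m]] _ up_le; first by rewrite mul0r; lra.
  rewrite -addn2 addnK natrD in up_le *; have m0 : 0 <= m%:R :> R := ler0n _ _.
  by nra.
rewrite -(ler_pM2l (_ : 0 < m%:R)) ?ltr0n // mulrA.
apply: le_trans (ler_wpM2r (ler0n _ _) decay) _.
rewrite -mulrA (le_trans (ler_wpM2l (ler0n _ _) IH)) //.
by rewrite [leLHS]mulrCA [leRHS]mulrCA -!natrM binm.
Qed.

Definition distinct_times (n : nat) (l : seq nat) : bool := uniq l && all (gtn n) l.

Lemma size_distinct_times n l : distinct_times n l -> (size l <= n)%N.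
Proof.
move=> /andP[ul /allP ln]; rewrite -[leqRHS](size_iota 0).
by apply: uniq_leq_size => // i /ln; rewrite mem_iota.
Qed.

Lemma distinct_times_iota n i k : (i + k <= n)%N -> distinct_times n (iota i k).
Proof.
move=> ikn; rewrite /distinct_times iota_uniq.
by apply/allP => j; rewrite mem_iota /=; lia.
Qed.

Lemma distinct_times_rcons_iota n p q : (p <= q < n)%N ->
  distinct_times n (rcons (iota 0 p) q).
Proof.
move=> /andP[pq qn]; rewrite /distinct_times rcons_uniq iota_uniq mem_iota.
by rewrite -leqNgt pq all_rcons /= qn; apply/allP => i; rewrite mem_iota /=; lia.
Qed.

Lemma distinct_times_rcons_iotaS n m p : (m + p < n)%N ->
  distinct_times n (rcons (iota m.+1 p) m).
Proof.
move=> mpn; rewrite /distinct_times rcons_uniq all_rcons -cons_uniq.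
by have := @distinct_times_iota n m p.+1; rewrite addnS; apply.
Qed.

Lemma distinct_times_perm_iota n z : perm_eq z (iota 0 n) -> distinct_times n z.
Proof.
move=> pz; rewrite /distinct_times (perm_uniq pz) (perm_all _ pz).
exact: (@distinct_times_iota n 0 n).
Qed.

Lemma distinct_times_take n k z : distinct_times n z -> distinct_times n (take k z).
Proof.
move=> /andP[uz /allP zn]; rewrite /distinct_times take_uniq //.
by apply/allP => i /mem_take /zn.
Qed.

Lemma distinct_times_iota_cat n m l : (m <= n)%N -> all (leq m) l ->
  distinct_times n l -> distinct_times n (iota 0 m ++ l).
Proof.
move=> mn /allP ml /andP[ul ln].
rewrite /distinct_times cat_uniq all_cat ln ul iota_uniq !andbT /=.
have /andP[_ ->] := @distinct_times_iota n 0 m mn; rewrite andbT.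
by apply/hasPn => i /ml mi; rewrite mem_iota /= -leqNgt.
Qed.

Section RandomOrder.
Context {N : finType}.
Implicit Types (s : {perm N}) (l : seq nat).

Lemma exists_perm_map (u w : seq N) : uniq u -> uniq w -> size u = size w ->
  exists s : {perm N}, map s u = w.
Proof.
elim/last_ind: u w => [|u a IH] w.
  by move=> _ _ /esym/size0nil->; exists 1%g.
case/lastP: w => [|w b]; first by rewrite size_rcons.
rewrite !rcons_uniq !size_rcons => /andP[au uu] /andP[bw uw] [suw].
have [s sE] := IH w uu uw suw.
exists (s * tperm (s a) b)%g; rewrite map_rcons permM tpermL; congr rcons.
rewrite -sE -[RHS]map_id -map_comp; apply/eq_in_map => c cu /=.
rewrite permM tpermD // -?sE; first by apply: contraNneq au => /perm_inj->.
by apply: contraNneq bw => ->; rewrite -sE map_f.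
Qed.

Lemma card_perm_gt0 : (0 < #|{perm N}|)%N.
Proof. by apply/card_gt0P; exists 1%g. Qed.

Lemma sum_perm_map (V : nmodType) (F : seq N -> V) (u w : seq N) :
  uniq u -> uniq w -> size u = size w ->
  \sum_(s : {perm N}) F (map s u) = \sum_(s : {perm N}) F (map s w).
Proof.
move=> uu uw /(exists_perm_map uu uw)[p <-].
rewrite (reindex_inj (mulgI p)); apply: eq_bigr => s _.
by rewrite -map_comp; congr F; apply: eq_map => c /=; rewrite permM.
Qed.

Variable x0 : N.

Definition arrival s (i : nat) : N := s (nth x0 (enum N) i).

Lemma map_arrival_iota s : map (arrival s) (iota 0 #|N|) = map s (enum N).
Proof.
by rewrite -[in RHS](mkseq_nth x0 (enum N)) -cardE /mkseq -map_comp.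
Qed.

Lemma uniq_map_arrival s l : distinct_times #|N| l -> uniq (map (arrival s) l).
Proof.
move=> /andP[ul /allP ltl]; rewrite map_inj_in_uniq // => i k /ltl il /ltl kl.
by move/perm_inj/eqP; rewrite nth_uniq -?cardE ?enum_uniq // => /eqP.
Qed.

Lemma sum_perm_arrival (V : nmodType) (F : seq N -> V) l l' :
  distinct_times #|N| l -> distinct_times #|N| l' -> size l = size l' ->
  \sum_s F (map (arrival s) l) = \sum_s F (map (arrival s) l').
Proof.
have mapE s k : map (arrival s) k = map s (map (arrival 1) k).
  by rewrite -map_comp; apply: eq_map => i; rewrite /= /arrival perm1.
move=> tl tl' sl; under eq_bigr do rewrite mapE; under [RHS]eq_bigr do rewrite mapE.
by apply: sum_perm_map; rewrite ?size_map // uniq_map_arrival.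
Qed.

Lemma sum_perm_arrival_split (V : nmodType) (F : seq N -> seq N -> N -> V)
    l k i l' k' i' :
  distinct_times #|N| (l ++ rcons k i) ->
  distinct_times #|N| (l' ++ rcons k' i') ->
  size l = size l' -> size k = size k' ->
  \sum_s F (map (arrival s) l) (map (arrival s) k) (arrival s i)
  = \sum_s F (map (arrival s) l') (map (arrival s) k') (arrival s i').
Proof.
move=> tl tl' sl sk.
pose G w := F (take (size l) w) (take (size k) (drop (size l) w)) (last x0 w).
have GE j a b : size a = size l -> size b = size k ->
    \sum_s F (map (arrival s) a) (map (arrival s) b) (arrival s j)
    = \sum_s G (map (arrival s) (a ++ rcons b j)).
  move=> sa sb; apply: eq_bigr => s _; rewrite /G map_cat last_cat map_rcons.
  rewrite last_rcons -sa -sb take_size_cat ?size_map // drop_size_cat ?size_map //.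
  by rewrite -cats1 take_size_cat ?size_map.
by rewrite !GE //; apply: sum_perm_arrival; rewrite ?size_cat ?size_rcons ?sl ?sk.
Qed.

End RandomOrder.

Section Runs.
Context {N M : finType} (alg : @online_rule N M).
Implicit Types (t : seq N) (S : M -> {set N}).

Definition graph S : {set N * M} := [set y | y.1 \in S y.2].

Definition run t : {set N * M} := graph (bundle alg t).

Lemma mem_run t j l :
  ((j, l) \in run t) = (j \in t) && (alg (take (index j t) t) j == l).
Proof. by rewrite !inE. Qed.

Lemma mem_run_cat t t' y : y.1 \in t -> (y \in run (t ++ t')) = (y \in run t).
Proof.
case: y => j l /= jt; rewrite !mem_run mem_cat jt index_cat jt /=.
by rewrite takel_cat // ltnW // index_mem.
Qed.

Lemma mem_run_item t y : y \in run t -> y.1 \in t.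
Proof. by case: y => j l; rewrite mem_run => /andP[]. Qed.

Lemma run_cat_subset t t' : run t \subset run (t ++ t').
Proof. by apply/subsetP => y yt; rewrite mem_run_cat // mem_run_item. Qed.

Lemma run_rcons t j : j \notin t -> run (rcons t j) = (j, alg t j) |: run t.
Proof.
move=> jt; apply/setP => -[i l]; rewrite in_setU1 xpair_eqE.
have [->|ij] := eqVneq i j.
  rewrite !mem_run (negPf jt) mem_rcons mem_head orbF -cats1 index_cat (negPf jt).
  by rewrite /= eqxx addn0 take_size_cat // eq_sym.
have [it|it] := boolP (i \in t); first by rewrite -cats1 mem_run_cat.
by rewrite !mem_run mem_rcons inE (negPf ij) (negPf it).
Qed.

Context {I : finType} (colour : nat -> I).
Implicit Types r : I.

Definition run_class r t : {set N * M} :=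
  [set y in run t | colour (index y.1 t) == r].

Lemma run_class_cat_subset r t t' : run_class r t \subset run_class r (t ++ t').
Proof.
apply/subsetP => y; rewrite [in X in X -> _]inE => /andP[yt yr].
have y1 := mem_run_item yt.
by rewrite inE mem_run_cat // yt index_cat y1.
Qed.

Lemma bigcup_run_class t : \bigcup_r run_class r t = run t.
Proof.
apply/setP => y; apply/bigcupP/idP => [[r _]|yt]; first by rewrite inE => /andP[].
by exists (colour (index y.1 t)); rewrite // inE yt eqxx.
Qed.

Lemma run_class_subset x0 r t : run_class r t \subset
  [set:: [seq (j, alg (take (index j t) t) j)
         | j <- [seq nth x0 t i | i <- iota 0 (size t) & colour i == r]]].
Proof.
apply/subsetP => -[j l]; rewrite !inE /= => /andP[/andP[jt /eqP <-] jr].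
rewrite map_f // -{1}(nth_index x0 jt) map_f // mem_filter jr mem_iota.
by rewrite index_mem.
Qed.

End Runs.

Section Residues.
Implicit Types (r : 'I_3) (B k : nat).

Lemma nonresidues_block r B : exists a b,
  [/\ [seq i <- iota (3 * B) 3 | inZp i != r] = [:: a; b],
      (3 * B <= a)%N & (3 * B <= b)%N].
Proof.
have modE j : ((3 * B + j) %% 3 = j %% 3)%N by rewrite mulnC modnMDl.
rewrite -[X in iota X]addn0 iotaDl filter_map /=.
case: r => [[|[|[|//]]] r3]; rewrite /= -!val_eqE /= !modE /=;
  by do 2!eexists; (split; [reflexivity| |]); apply: leq_addr.
Qed.

Lemma iota_mul3S B : iota 0 (3 * B.+1) = iota 0 (3 * B) ++ iota (3 * B) 3.
Proof. by rewrite mulnS addnC iotaD. Qed.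

Lemma size_nonresidues r B : size [seq i <- iota 0 (3 * B) | inZp i != r] = (2 * B)%N.
Proof.
elim: B => // B IH; rewrite iota_mul3S filter_cat size_cat IH.
by have [a [b [-> _ _]]] := nonresidues_block r B; rewrite mulnS addnC.
Qed.

Lemma nth_rev_nonresidues_ge r B k : (k < 2 * B)%N ->
  (3 * (B.-1 - k./2) <= nth 0 (rev [seq i <- iota 0 (3 * B) | inZp i != r]) k)%N.
Proof.
elim: B k => // B IH k kB; rewrite iota_mul3S filter_cat rev_cat.
have [a [b [-> a_ge b_ge]]] := nonresidues_block r B.
case: k kB => [|[|k]] kB /=; try lia.
by apply: leq_trans (IH k _); lia.
Qed.

End Residues.

Definition greedy_on (R : realType) (N M : finType) (f : {set N * M} -> R)
    (alg : @online_rule N M) : Prop :=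
  forall h j l, uniq (rcons h j) ->
    MG f (run alg h) (j, l) <= MG f (run alg h) (j, alg h j).

Section GreedyRun.
Context {R : realType} {N M : finType} {f : {set N * M} -> R}.
Context {alg : @online_rule N M}.
Hypothesis f_val : valuation f.
Hypothesis alg_greedy : greedy_on f alg.
Implicit Types (u w : seq N) (c : N -> M).

Lemma greedy_gain_ge u j l : uniq (rcons u j) ->
  MG f (run alg u) (j, l) <= f (run alg (rcons u j)) - f (run alg u).
Proof.
move=> uj; rewrite run_rcons; first exact: alg_greedy.
by move: uj; rewrite rcons_uniq => /andP[].
Qed.

Lemma sum_rival_marginals c u w : uniq (u ++ w) ->
  \sum_(j <- w) MG f (run alg (u ++ w)) (j, c j)
  <= f (run alg (u ++ w)) - f (run alg u).
Proof.
elim/last_ind: w => [|w j IH]; first by rewrite big_nil cats0 subrr.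
rewrite -rcons_cat => uwj; have /IH {}IH : uniq (u ++ w).
  by move: uwj; rewrite rcons_uniq => /andP[].
have anti i : MG f (run alg (rcons (u ++ w) j)) (i, c i)
              <= MG f (run alg (u ++ w)) (i, c i).
  by apply: MG_anti => //; rewrite -cats1 run_cat_subset.
have sum_le : \sum_(i <- w) MG f (run alg (rcons (u ++ w) j)) (i, c i)
              <= \sum_(i <- w) MG f (run alg (u ++ w)) (i, c i).
  by apply: ler_sum => i _.
have := anti j; have := greedy_gain_ge (c j) uwj.
by rewrite big_rcons /=; lra.
Qed.

Lemma late_rivals_le c u w : uniq (u ++ w) ->
  f (run alg (u ++ w) :|: [set:: [seq (j, c j) | j <- w]])
  <= 2 * f (run alg (u ++ w)) - f (run alg u).
Proof.
move=> uw; apply: le_trans (valuation_setU_le f_val _ _) _.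
by rewrite big_map; have := sum_rival_marginals c uw; lra.
Qed.

End GreedyRun.

Section GreedyAverages.
Context {R : realType} {N M : finType} (x0 : N) {f : {set N * M} -> R}.
Context {alg : @online_rule N M} (a : N -> M).
Hypothesis f_val : valuation f.
Hypothesis alg_greedy : greedy_on f alg.
Implicit Types (s : {perm N}) (l u w : seq nat) (p q m : nat) (S : {set N * M}).

Local Notation n := #|N|.
Local Notation arrivals s l := (map (arrival x0 s) l).
Local Notation opt_set := (graph (fun l : M => [set j | a j == l])).

(* Expectations over the random order are kept as unnormalized sums over all
   permutations. *)
Definition total_opt : R := \sum_(s : {perm N}) f opt_set.

Definition total_value p : R :=
  \sum_(s : {perm N}) f (run alg (arrivals s (iota 0 p))).

Definition opt_marginal s i S : R :=
  MG f S (arrival x0 s i, a (arrival x0 s i)).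

Definition total_marginal p : R :=
  \sum_s opt_marginal s p (run alg (arrivals s (iota 0 p))).

Definition cumulative_marginal p : R := \sum_(0 <= i < p) total_marginal i.

Local Notation Q := total_opt.
Local Notation g := total_value.
Local Notation x := total_marginal.
Local Notation X := cumulative_marginal.

Lemma total_valueE l : distinct_times n l ->
  \sum_(s : {perm N}) f (run alg (arrivals s l)) = g (size l).
Proof.
move=> tl; apply: (sum_perm_arrival x0 (fun h => f (run alg h))) => //.
  by apply: distinct_times_iota; rewrite add0n size_distinct_times.
by rewrite size_iota.
Qed.

Lemma total_marginalE l i : distinct_times n (rcons l i) ->
  \sum_s opt_marginal s i (run alg (arrivals s l)) = x (size l).
Proof.
move=> tli.
apply: (sum_perm_arrival_split x0 (l := [::]) (l' := [::])
  (fun _ h j => MG f (run alg h) (j, a j))); rewrite ?size_iota //.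
apply: distinct_times_rcons_iota.
by rewrite leqnn -(size_rcons l i) size_distinct_times.
Qed.

Lemma opt_marginal_anti s i S S' :
  S \subset S' -> opt_marginal s i S' <= opt_marginal s i S.
Proof. exact: MG_anti. Qed.

Lemma total_opt_ge0 : 0 <= Q.
Proof. by apply: sumr_ge0 => s _; apply: valuation_ge0. Qed.

Lemma total_value_ge0 p : 0 <= g p.
Proof. by apply: sumr_ge0 => s _; apply: valuation_ge0. Qed.

Lemma total_marginal_ge0 p : 0 <= x p.
Proof. by apply: sumr_ge0 => s _; apply: MG_ge0. Qed.

Lemma run_iota_subset s p q : (p <= q)%N ->
  run alg (arrivals s (iota 0 p)) \subset run alg (arrivals s (iota 0 q)).
Proof. by move=> pq; rewrite -(subnKC pq) iotaD map_cat run_cat_subset. Qed.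

Lemma total_marginal_anti p q : (p <= q < n)%N -> x q <= x p.
Proof.
move=> pq; rewrite -[p in leRHS](size_iota 0).
rewrite -(total_marginalE (distinct_times_rcons_iota pq)).
apply: ler_sum => s _; apply/opt_marginal_anti/run_iota_subset.
by case/andP: pq.
Qed.

Lemma total_value_step p : (p < n)%N -> x p <= g p.+1 - g p.
Proof.
move=> pn; rewrite -sumrB; apply: ler_sum => s _.
rewrite -!/(mkseq _ _) mkseqS greedy_gain_ge // -mkseqS.
exact/uniq_map_arrival/distinct_times_iota.
Qed.

Lemma cumulative_marginalB p q : (p <= q)%N -> X q - X p = \sum_(p <= i < q) x i.
Proof. by move=> pq; rewrite /X (big_cat_nat (leq0n p) pq) /= addrAC subrr add0r. Qed.

Lemma cumulative_marginal_le p q : (p <= q)%N -> X p <= X q.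
Proof.
move=> pq; rewrite -subr_ge0 cumulative_marginalB //.
by apply: sumr_ge0 => i _; apply: total_marginal_ge0.
Qed.

Lemma cumulative_marginal_le_value p q : (p <= q <= n)%N -> X q - X p <= g q - g p.
Proof.
move=> /andP[pq qn]; rewrite cumulative_marginalB // -(telescope_sumr _ pq).
rewrite !big_nat; apply: ler_sum => i /andP[_ iq].
by apply: total_value_step; apply: leq_trans qn.
Qed.

Lemma mulr_marginal_le p q : (p <= q < n)%N -> (q - p)%:R * x q <= X q - X p.
Proof.
move=> /andP[pq qn]; rewrite cumulative_marginalB // mulr_natl -sumr_const_nat.
rewrite !big_nat; apply: ler_sum => i /andP[_ iq].
by rewrite total_marginal_anti // (ltnW iq).
Qed.

Lemma opt_le_sum s S : f opt_set <= f S + \sum_(i <- iota 0 n) opt_marginal s i S.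
Proof.
have -> : \sum_(i <- iota 0 n) opt_marginal s i S
          = \sum_(y <- [seq (j, a j) | j <- map s (enum N)]) MG f S y.
  by rewrite -(map_arrival_iota x0) !big_map.
apply: le_trans (valuation_setU_le f_val _ _); apply: valuation_le => //.
apply/subsetP => -[j l]; rewrite !inE /= => /eqP <-.
by rewrite map_f ?orbT // -[j](permKV s) map_f // mem_enum.
Qed.

Lemma opt_le_value_marginals p : (p < n)%N -> Q <= g p + X p + (n - p)%:R * x p.
Proof.
move=> pn; pose A s := run alg (arrivals s (iota 0 p)).
have Q_le : Q <= \sum_s (f (A s) + \sum_(0 <= i < n) opt_marginal s i (A s)).
  apply: ler_sum => s _; apply: le_trans (opt_le_sum s _) _.
  by rewrite /index_iota subn0.
apply: le_trans Q_le _; rewrite big_split /= exchange_big /= -addrA lerD2l.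
rewrite (big_cat_nat (leq0n p) (ltnW pn)) /=; apply: lerD; rewrite /X !big_nat.
  apply: ler_sum => i /andP[_ ip]; apply: ler_sum => s _.
  by apply/opt_marginal_anti/run_iota_subset/ltnW.
rewrite (eq_bigr (fun=> x p)) => [|i ip].
  by rewrite -big_nat sumr_const_nat mulr_natl.
by rewrite total_marginalE ?size_iota // distinct_times_rcons_iota.
Qed.

(* The ratio of binomials of [quadratic_decay] is at most [t ^+ 2]. *)
Lemma value_marginals_lb p (t : R) : (1 < n)%N -> (p <= n)%N ->
  (n - p)%:R <= t * n%:R -> Q * (1 - t ^+ 2) <= g p + X p.
Proof.
move=> n_gt1 pn np_le.
have decay : (Q - (g p + X p)) * 'C(n, 2)%:R <= Q * 'C(n - p, 2)%:R.
  have := @quadratic_decay R n (fun p => Q - (g p + X p)) x.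
  move=> /(_ (fun p _ => total_marginal_ge0 p) _ _ p pn) decay.
  apply: le_trans (decay _ _) _ => [k kn|k kn|].
  - by have := opt_le_value_marginals kn; lra.
  - by have := total_value_step kn; rewrite /X big_nat_recr //=; lra.
  - rewrite ler_wpM2r // /X big_geq // addr0.
    by have := total_value_ge0 0; lra.
have n_gt0 : 0 < n%:R :> R by rewrite ltr0n; lia.
have bin_gt0 : 0 < 'C(n, 2)%:R :> R by rewrite ltr0n bin_gt0.
suff bin_le : 'C(n - p, 2)%:R <= 'C(n, 2)%:R * t ^+ 2.
  rewrite -(ler_pM2r bin_gt0); by have := ler_wpM2l total_opt_ge0 bin_le; lra.
rewrite -(ler_pM2r (exprn_gt0 2 n_gt0)) -mulrA -exprMn.
have := bin2_sqr_le (leq_subr p n); rewrite -(ler_nat R) natrM [leRHS]natrM !natrX.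
move/le_trans; apply; rewrite ler_wpM2l //.
by apply: lerXn2r; rewrite ?nnegrE // (le_trans _ np_le).
Qed.

Section Classes.
Context {I : finType} (colour : nat -> I).
Implicit Types r : I.

Definition class_marginal r m p : R :=
  \sum_s opt_marginal s m (run alg (arrivals s (iota m.+1 p))
                           :|: run_class alg colour r (arrivals s (iota 0 m))).

Lemma class_marginalE r m l i : (m <= n)%N -> all (leq m) (rcons l i) ->
  distinct_times n (rcons l i) ->
  \sum_s opt_marginal s i (run alg (arrivals s l)
                           :|: run_class alg colour r (arrivals s (iota 0 m)))
  = class_marginal r m (size l).
Proof.
move=> mn m_le tli; have tcat := distinct_times_iota_cat mn m_le tli.
have mln : (m + size l < n)%N.
  by have := size_distinct_times tcat; rewrite size_cat size_iota size_rcons; lia.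
apply: (sum_perm_arrival_split x0
  (fun b h j => MG f (run alg h :|: run_class alg colour r b) (j, a j)));
  rewrite ?size_iota //.
apply: distinct_times_iota_cat; rewrite ?distinct_times_rcons_iotaS //.
by apply/allP => k; rewrite mem_rcons inE mem_iota; lia.
Qed.

Hypothesis f_sos : second_order_supermodular f.

Lemma sum_class_marginal m p : (m + p < n)%N ->
  \sum_r class_marginal r m p <= (#|I|%:R - 1) * x p + x m.
Proof.
move=> mpn; rewrite exchange_big /=.
rewrite -[p in x p](size_iota m.+1).
rewrite -(total_marginalE (distinct_times_rcons_iotaS mpn)).
rewrite mulr_sumr -big_split; apply: ler_sum => s _ /=.
set Y := run alg (arrivals s (iota m.+1 p)); set K := arrivals s (iota 0 m).
have := damage_bigcup f_val f_sos (index_enum I) xpredT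
  (fun r => run_class alg colour r K) Y (arrival x0 s m, a (arrival x0 s m)).
rewrite bigcup_run_class /damage sumrB sumr_const -mulr_natl.
rewrite -/(opt_marginal s m Y) -/(opt_marginal s m (Y :|: run alg K)).
have := opt_marginal_anti s m (subsetUr Y (run alg K)).
by rewrite /opt_marginal; lra.
Qed.

Lemma late_class_le s r m u w : perm_eq (u ++ w) (iota 0 n) -> (m <= n)%N ->
  {subset [seq i <- iota 0 m | colour i == r] <= w} ->
  f (run alg (arrivals s (u ++ w))
     :|: run_class alg colour r (arrivals s (iota 0 m)))
  <= 2 * f (run alg (arrivals s (u ++ w))) - f (run alg (arrivals s u)).
Proof.
move=> uw mn late; set K := arrivals s (iota 0 m).
pose c j := alg (take (index j K) K) j.
have := uniq_map_arrival x0 s (distinct_times_perm_iota uw); rewrite map_cat.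
move/(late_rivals_le f_val alg_greedy c); apply: le_trans.
apply: valuation_le => //; apply/setUS/(subset_trans (run_class_subset _ _ x0 _ _)).
apply/subsetP => y; rewrite !inE => /mapP[_ /mapP[i iK ->] ->].
rewrite map_f //; move: iK (late i); rewrite size_map size_iota => iK /(_ iK) iw.
move: iK; rewrite mem_filter mem_iota => /andP[_ im].
by rewrite (nth_map 0%N) ?size_iota // nth_iota // map_f.
Qed.

Lemma marginal_reordered_le z p (B : {perm N} -> {set N * M}) :
  distinct_times n z -> (p < size z)%N ->
  (forall s, run alg (arrivals s (take p z)) \subset B s) ->
  \sum_s opt_marginal s (nth 0%N z p) (B s) <= x p.
Proof.
move=> tz pz sub_B; have tp := distinct_times_take p.+1 tz.
rewrite (take_nth 0%N) // in tp.
rewrite -[leRHS](congr1 x (size_takel (ltnW pz))) -(total_marginalE tp).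
by apply: ler_sum => s _; apply: opt_marginal_anti.
Qed.

Lemma class_marginal_reordered_le r z m m' p :
  distinct_times n z -> (p < size z)%N ->
  (m' <= m <= n)%N -> all (leq m') (take p.+1 z) ->
  \sum_s opt_marginal s (nth 0%N z p) (run alg (arrivals s z)
    :|: run_class alg colour r (arrivals s (iota 0 m))) <= class_marginal r m' p.
Proof.
move=> tz pz /andP[m'm mn] m'_le; have tp := distinct_times_take p.+1 tz.
rewrite (take_nth 0%N) // in tp m'_le.
rewrite -[p in leRHS](size_takel (ltnW pz)).
rewrite -(class_marginalE r (leq_trans m'm mn) m'_le tp).
apply: ler_sum => s _; apply/opt_marginal_anti/setUSS.
  by rewrite -{2}(cat_take_drop p z) map_cat run_cat_subset.
by rewrite -(subnKC m'm) iotaD map_cat run_class_cat_subset.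
Qed.

Lemma opt_le_reordered r m u w t q : perm_eq (u ++ w) (iota 0 n) -> (m <= n)%N ->
  {subset [seq i <- iota 0 m | colour i == r] <= w} -> (q <= n)%N ->
  (forall p, (p < q)%N -> (t p <= m)%N && all (leq (t p)) (take p.+1 (u ++ w))) ->
  Q <= 2 * g n - g (size u) + (X n - X q)
       + \sum_(0 <= p < q) class_marginal r (t p) p.
Proof.
move=> uw mn late qn t_le; set z := u ++ w in uw t_le.
have tz := distinct_times_perm_iota uw.
have sz : size z = n by rewrite (perm_size uw) size_iota.
pose A s := run alg (arrivals s z).
pose C s := run_class alg colour r (arrivals s (iota 0 m)).
have Q_le : Q <= \sum_s (2 * f (A s) - f (run alg (arrivals s u))
                  + \sum_(0 <= p < n) opt_marginal s (nth 0%N z p) (A s :|: C s)).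
  apply: ler_sum => s _; apply: le_trans (opt_le_sum s (A s :|: C s)) _.
  by rewrite lerD ?late_class_le // -(perm_big _ uw) (big_nth 0%N) sz.
apply: le_trans Q_le _.
rewrite big_split /= sumrB -mulr_sumr !total_valueE //; last first.
  by rewrite -(take_size_cat w (erefl (size u))) distinct_times_take.
rewrite sz -[leRHS]addrA lerD2l exchange_big /= cumulative_marginalB // [leRHS]addrC.
rewrite (big_cat_nat (leq0n q) qn) /=; apply: lerD;
  rewrite !big_nat; apply: ler_sum => p /andP[_ pq].
  have /andP[t_m t_z] : (t p <= m)%N && all (leq (t p)) (take p.+1 z) by apply: t_le.
  by apply: class_marginal_reordered_le; rewrite ?t_m // sz; lia.
apply: marginal_reordered_le => //; first by rewrite sz.
move=> s; apply: subset_trans (subsetUl _ _).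
by rewrite /A -{2}(cat_take_drop p z) map_cat run_cat_subset.
Qed.

Lemma opt_le_classes m k t q (u w : I -> seq nat) :
  (forall r, perm_eq (u r ++ w r) (iota 0 n)) -> (forall r, size (u r) = k) ->
  (m <= n)%N -> (forall r, {subset [seq i <- iota 0 m | colour i == r] <= w r}) ->
  (q <= n)%N ->
  (forall p, (p < q)%N -> (t p <= m)%N /\ (t p + p < n)%N) ->
  (forall r p, (p < q)%N -> all (leq (t p)) (take p.+1 (u r ++ w r))) ->
  #|I|%:R * Q <= #|I|%:R * (2 * g n - g k + (X n - X q))
                 + (#|I|%:R - 1) * X q + \sum_(0 <= p < q) x (t p).
Proof.
move=> uw uk mn late qn t_m t_uw.
have Q_le : \sum_(r : I) Q <= \sum_r (2 * g n - g k + (X n - X q)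
                                + \sum_(0 <= p < q) class_marginal r (t p) p).
  apply: ler_sum => r _; rewrite -(uk r).
  apply: opt_le_reordered (uw r) mn (late r) qn _.
  by move=> p pq; rewrite (t_m p pq).1 t_uw.
have class_le : \sum_r \sum_(0 <= p < q) class_marginal r (t p) p
                <= (#|I|%:R - 1) * X q + \sum_(0 <= p < q) x (t p).
  rewrite exchange_big /= mulr_sumr -big_split /= !big_nat.
  by apply: ler_sum => p /andP[_ pq]; apply/sum_class_marginal/(t_m p pq).2.
move: Q_le; rewrite big_split /= !sumr_const.
rewrite -(mulr_natl Q) -(mulr_natl (2 * g n - g k + (X n - X q))).
by lra.
Qed.

End Classes.

Hypothesis f_sos : second_order_supermodular f.

Section ThreeClasses.
Variables v B : nat.
Hypothesis n_eq : n = (v + 3 * B)%N.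

(* In the notation of the header, K consists of the first [3 * B] arrivals and J
   of the last [v]. *)
Definition early_times (r : 'I_3) : seq nat :=
  iota (3 * B) v ++ rev [seq i <- iota 0 (3 * B) | inZp i != r].

Definition late_times (r : 'I_3) : seq nat := [seq i <- iota 0 (3 * B) | inZp i == r].

Definition threshold p : nat :=
  (if p < v then 3 * B else 3 * (B.-1 - (p - v)./2))%N.

Lemma perm_reordered r : perm_eq (early_times r ++ late_times r) (iota 0 n).
Proof.
rewrite n_eq [(v + _)%N]addnC iotaD add0n -catA perm_catC perm_cat2r.
rewrite perm_catC (perm_catl _ (permEl (perm_rev _))).
by apply: permEl; apply: perm_filterC.
Qed.

Lemma size_early_times r : size (early_times r) = (v + 2 * B)%N.
Proof. by rewrite size_cat size_iota size_rev size_nonresidues. Qed.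

Lemma early_times_ge r p : (p < v + 2 * B)%N ->
  all (leq (threshold p)) (take p.+1 (early_times r ++ late_times r)).
Proof.
move=> pvB; rewrite takel_cat ?size_early_times //.
apply/(all_nthP 0%N) => i; rewrite size_takel ?size_early_times // ltnS => ip.
rewrite nth_take // nth_cat size_iota /threshold.
case: (ltnP i v) => [iv|vi]; first by rewrite nth_iota //; case: ifP => _; lia.
by apply: leq_trans (nth_rev_nonresidues_ge _ _); [case: ifP|]; lia.
Qed.

Lemma sum_marginal_blocks I : (I < B)%N ->
  3 * \sum_(0 <= k < 2 * I) x (3 * (B.-1 - k./2))
  <= 2 * (X (3 * B.-1) - X (3 * (B.-1 - I))).
Proof.
elim: I => [|I IH] IB; first by rewrite big_geq // subn0 mulr0 subrr mulr0.
rewrite mulnS !big_nat_recr //= mul2n doubleK uphalf_double -mul2n.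
have := IH (ltnW IB).
have := @mulr_marginal_le (3 * (B.-1 - I.+1)) (3 * (B.-1 - I)).
rewrite (_ : 3 * (B.-1 - I) - 3 * (B.-1 - I.+1) = 3)%N; last by lia.
by move=> /(_ ltac:(lia)); lra.
Qed.

Lemma sum_threshold_le I : (I < B)%N ->
  \sum_(0 <= p < v + 2 * I) x (threshold p)
  <= v%:R * x (3 * B) + 2 / 3 * (X (3 * B) - X (3 * (B.-1 - I))).
Proof.
move=> IB; rewrite (big_cat_nat (leq0n v) (leq_addr (2 * I) v)) /= lerD //.
  rewrite big_nat (eq_bigr (fun=> x (3 * B))) => [|p /andP[_ pv]].
    by rewrite -big_nat sumr_const_nat subn0 mulr_natl.
  by rewrite /threshold pv.
rewrite -{1}[v]add0n big_addn addKn.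
under eq_bigr do rewrite /threshold ltnNge leq_addl addnK /=.
have := sum_marginal_blocks IB.
have : X (3 * B.-1) <= X (3 * B) by apply: cumulative_marginal_le; lia.
by lra.
Qed.

Lemma opt_le_three_classes I : (I < B)%N ->
  3 * Q <= 3 * (2 * g n - g (v + 2 * B) + (X n - X (v + 2 * I))) + 2 * X (v + 2 * I)
           + v%:R * x (3 * B) + 2 / 3 * (X (3 * B) - X (3 * (B.-1 - I))).
Proof.
move=> IB.
have t_m p : (p < v + 2 * I)%N -> (threshold p <= 3 * B)%N /\ (threshold p + p < n)%N.
  by move=> pq; rewrite n_eq /threshold; case: ifP => pv; lia.
have t_reordered r p : (p < v + 2 * I)%N ->
    all (leq (threshold p)) (take p.+1 (early_times r ++ late_times r)).
  by move=> pq; apply: early_times_ge; lia.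
have Bn : (3 * B <= n)%N by lia.
have qn : (v + 2 * I <= n)%N by lia.
have := opt_le_classes f_sos perm_reordered size_early_times Bn
  (fun r i (ir : i \in late_times r) => ir) qn t_m t_reordered.
by rewrite card_ord; have := sum_threshold_le IB; lra.
Qed.

End ThreeClasses.

(* The positions 10L - 2, 12L, 15L, 18L (of 24L) were chosen to make the linear
   combination good enough; the bound obtained tends to 0.5106 as L grows. *)
Lemma greedy_total_value_ge L : n = (24 * L)%N -> (100 <= L)%N ->
  319 / 625 * Q <= g n.
Proof.
move=> n_eq L100.
have := @opt_le_three_classes (6 * L) (6 * L) ltac:(lia) (2 * L - 1) ltac:(lia).
rewrite (_ : 6 * L + 2 * (6 * L) = 18 * L)%N; last by lia.
rewrite (_ : 3 * (6 * L) = 18 * L)%N; last by lia.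
rewrite (_ : 6 * L + 2 * (2 * L - 1) = 10 * L - 2)%N; last by lia.
rewrite (_ : 3 * ((6 * L).-1 - (2 * L - 1)) = 12 * L)%N; last by lia.
have tail : (6 * L)%:R * x (18 * L) <= 2 * (X (18 * L) - X (15 * L)).
  have := @mulr_marginal_le (15 * L) (18 * L) ltac:(lia).
  rewrite (_ : 18 * L - 15 * L = 3 * L)%N; last by lia.
  rewrite (_ : 6 * L = 2 * (3 * L))%N; last by lia.
  by rewrite [(2 * _)%:R]natrM; lra.
have lb p k d : (p <= n)%N -> (0 < d)%N -> (d * (n - p) <= k * n)%N ->
    Q * (1 - (k%:R / d%:R) ^+ 2) <= g p + X p.
  move=> pn d_gt0 le_kn; apply: value_marginals_lb => //; first by lia.
  by rewrite mulrAC ler_pdivlMr ?ltr0n // mulrC -!natrM ler_nat.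
have lb10 := @lb (10 * L - 2)%N 117 200 ltac:(lia) isT ltac:(lia).
have lb12 := @lb (12 * L)%N 1 2 ltac:(lia) isT ltac:(lia).
have lb15 := @lb (15 * L)%N 3 8 ltac:(lia) isT ltac:(lia).
have lb18 := @lb (18 * L)%N 1 4 ltac:(lia) isT ltac:(lia).
have := @cumulative_marginal_le_value (10 * L - 2) (18 * L) ltac:(lia).
have := @cumulative_marginal_le_value (12 * L) (18 * L) ltac:(lia).
have := @cumulative_marginal_le_value (15 * L) (18 * L) ltac:(lia).
have := @cumulative_marginal_le_value (18 * L) n ltac:(lia).
have := @cumulative_marginal_le_value 0 (18 * L) ltac:(lia).
have := total_value_ge0 0; have := total_opt_ge0.
have : X 0 = 0 by rewrite /X big_geq.
by lra.
Qed.

End GreedyAverages.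

Section PairWelfare.
Context {R : realType} {N M : finType} {v : M -> {set N} -> R}.
Context {alg : @online_rule N M}.

Definition pair_welfare (S : {set N * M}) : R := \sum_l v l (pair^~ l @^-1: S).

Lemma pair_inj (l : M) : injective (fun j : N => (j, l)).
Proof. by move=> i j []. Qed.

Lemma preim_graph (S : M -> {set N}) l : pair^~ l @^-1: graph S = S l.
Proof. by apply/setP => j; rewrite !inE. Qed.

Lemma pair_welfare_graph S : pair_welfare (graph S) = welfare v S.
Proof. by apply: eq_bigr => l _; rewrite preim_graph. Qed.

Lemma MG_pair_welfare S j l :
  MG pair_welfare S (j, l) = MG (v l) (pair^~ l @^-1: S) j.
Proof.
rewrite MG_sum (bigD1 l) //= (MG_preim _ (@pair_inj l)) big1 ?addr0 // => l' l'l.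
by apply: MG_preim_notin => i; rewrite xpair_eqE (negPf l'l) andbF.
Qed.

Lemma greedy_on_pair_welfare : greedy v alg -> greedy_on pair_welfare alg.
Proof.
by move=> alg_greedy h j l hj; rewrite !MG_pair_welfare !preim_graph alg_greedy.
Qed.

Hypothesis v_val : forall l, valuation (v l).
Hypothesis v_sos : forall l, second_order_supermodular (v l).

Lemma expected_welfare_ge0 : 0 <= expected_welfare v alg.
Proof.
rewrite divr_ge0 ?ler0n //; apply: sumr_ge0 => s _; apply: sumr_ge0 => l _.
exact: valuation_ge0.
Qed.

Lemma greedy_expected_welfare_divisible L : #|N| = (24 * L)%N -> (100 <= L)%N ->
  greedy v alg -> 319 / 625 * OPT v <= expected_welfare v alg.
Proof.
move=> n_eq L100 alg_greedy.
have /card_gt0P[x0 _] : (0 < #|N|)%N by lia.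
rewrite mulrC -ler_pdivlMr; last by lra.
apply: bigmax_le => [|a _]; first by rewrite divr_ge0 ?expected_welfare_ge0 //; lra.
rewrite ler_pdivlMr; last by lra.
rewrite ler_pdivlMr ?ltr0n ?card_perm_gt0 //.
have f_val := valuation_sum (fun l => valuation_preim (pair^~ l) (v_val l)).
have f_sos := second_order_supermodular_sum
  (fun l => second_order_supermodular_preim (@pair_inj l) (v_sos l)).
have f_greedy := greedy_on_pair_welfare alg_greedy.
have := greedy_total_value_ge x0 a f_val f_greedy f_sos n_eq L100.
rewrite /total_opt /total_value sumr_const -[_ *+ _]mulr_natr.
rewrite -/(pair_welfare _) pair_welfare_graph.
under [in X in _ <= X]eq_bigr do
  rewrite -/(pair_welfare _) pair_welfare_graph map_arrival_iota.
by lra.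
Qed.

End PairWelfare.

Section Padding.
Context {R : realType} {N M D : finType} (v : M -> {set N} -> R).
Context (alg : @online_rule N M) (m0 : M).
Implicit Types (h : seq (N + D)%type).

Definition pad_valuation l (S : {set N + D}) : R := v l (inl @^-1: S).

Definition unpad h : seq N := pmap (fun y => if y is inl j then Some j else None) h.

Definition pad_rule : online_rule :=
  fun h y => if y is inl j then alg (unpad h) j else m0.

Lemma mem_unpad h j : (j \in unpad h) = (inl j \in h).
Proof. by elim: h => [|[i|k] h IH] //=; rewrite !inE ?IH. Qed.

Lemma unpad_rcons h j : unpad (rcons h (inl j)) = rcons (unpad h) j.
Proof. by rewrite -cats1 /unpad pmap_cat cats1. Qed.

Lemma uniq_unpad h : uniq h -> uniq (unpad h).
Proof.
elim: h => [|[j|k] h IH] //= /andP[yh /IH ->] //.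
by rewrite -/(unpad h) mem_unpad yh.
Qed.

Lemma unpad_take_index h j :
  unpad (take (index (inl j) h) h) = take (index j (unpad h)) (unpad h).
Proof.
elim: h => [|[i|k] h IH] //=; rewrite -?/(unpad _) -?IH //.
by rewrite (inj_eq (@inl_inj N D)); case: eqP => //= _; rewrite -/(unpad _) IH.
Qed.

Lemma preim_bundle_pad h l : inl @^-1: bundle pad_rule h l = bundle alg (unpad h) l.
Proof. by apply/setP => j; rewrite !inE mem_unpad /pad_rule unpad_take_index. Qed.

Lemma greedy_pad : greedy v alg -> greedy pad_valuation pad_rule.
Proof.
move=> alg_greedy h [j|k] hy l; last by rewrite !MG_preim_notin.
rewrite !(MG_preim _ (@inl_inj N D)) !preim_bundle_pad.
by apply: alg_greedy; rewrite -unpad_rcons uniq_unpad.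
Qed.

Lemma OPT_pad_ge : OPT v <= OPT pad_valuation.
Proof.
apply: bigmax_le => [|a _]; first exact: bigmax_ge_id.
pose a' : {ffun N + D -> M} := [ffun y => if y is inl j then a j else m0].
apply: (bigmax_sup a') => //; apply: ler_sum => l _.
rewrite /pad_valuation (_ : _ @^-1: _ = [set j | a j == l]) //.
by apply/setP => j; rewrite !inE ffunE.
Qed.

(* Double counting: relabelling the real items by a uniform permutation and then
   dropping the dummies from a uniform order gives a uniform order of the items. *)
Lemma sum_unpad (F : seq N -> R) :
  #|{perm N}|%:R * \sum_(t : {perm N + D}) F (unpad (map t (enum {: N + D})))
  = #|{perm N + D}|%:R * \sum_(s : {perm N}) F (map s (enum N)).
Proof.
pose ext (s : {perm N}) (y : N + D) : N + D := if y is inl j then inl (s j) else y.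
have ext_inj s : injective (ext s) by move=> [i|i] [k|k] //= [/perm_inj->].
have unpad_ext (s : {perm N}) h : unpad (map (ext s) h) = map s (unpad h).
  by elim: h => [|[j|k] h IH] //=; rewrite -/(unpad _) IH.
transitivity (\sum_(s : {perm N}) \sum_(t : {perm N + D})
                F (map s (unpad (map t (enum {: N + D}))))).
  rewrite mulr_natl -sumr_const; apply: eq_bigr => s _.
  rewrite (reindex_inj (mulIg (perm (ext_inj s)))); apply: eq_bigr => t _.
  rewrite -unpad_ext -(map_comp (ext s)); congr (F (unpad _)); apply: eq_map => y /=.
  by rewrite permM permE.
rewrite exchange_big mulr_natl -sumr_const; apply: eq_bigr => t _ /=.
have uniq_t : uniq (map t (enum {: N + D})).
  by rewrite map_inj_uniq ?enum_uniq //; apply: perm_inj.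
apply: sum_perm_map; rewrite ?uniq_unpad ?enum_uniq //.
rewrite -cardE -(card_uniqP (uniq_unpad uniq_t)); apply: eq_card => j.
rewrite mem_unpad -[inl j](permKV t) mem_map ?mem_enum //.
exact: perm_inj.
Qed.

Lemma expected_welfare_pad :
  expected_welfare pad_valuation pad_rule = expected_welfare v alg.
Proof.
apply/eqP; rewrite eqr_div ?pnatr_eq0 -?lt0n ?card_perm_gt0 //.
rewrite [eqbLHS]mulrC [eqbRHS]mulrC.
rewrite -(sum_unpad (fun t => welfare v (bundle alg t))); apply/eqP; congr (_ * _).
apply: eq_bigr => t _; apply: eq_bigr => l _.
by rewrite /pad_valuation preim_bundle_pad.
Qed.

End Padding.

Lemma OPT_gt0_agent (R : realType) (N M : finType) (v : M -> {set N} -> R) :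
  0 < OPT v -> (0 < #|M|)%N.
Proof.
move=> OPT_gt0; rewrite lt0n; apply: contraTneq OPT_gt0 => /card0_eq M0.
rewrite -leNgt; apply: bigmax_le => // a _.
by rewrite /welfare big_pred0 // => l; rewrite -(M0 l).
Qed.

Lemma greedy_expected_welfare_ge (R : realType) (N M : finType)
    (v : M -> {set N} -> R) (alg : @online_rule N M) :
  (forall l, valuation (v l)) -> (forall l, second_order_supermodular (v l)) ->
  greedy v alg -> 0 < OPT v -> 319 / 625 * OPT v <= expected_welfare v alg.
Proof.
move=> v_val v_sos alg_greedy /OPT_gt0_agent/card_gt0P[m0 _].
have [L L100 NL] : exists2 L, (100 <= L)%N & (#|N| <= 24 * L)%N.
  by exists (100 + #|N|)%N; lia.
pose D := 'I_(24 * L - #|N|).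
have ND : #|{: N + D}| = (24 * L)%N by rewrite card_sum card_ord subnKC.
apply: le_trans (_ : _ <= 319 / 625 * OPT (@pad_valuation R N M D v)) _.
  by apply: ler_wpM2l (OPT_pad_ge v m0); lra.
rewrite -(@expected_welfare_pad R N M D v alg m0).
apply: greedy_expected_welfare_divisible ND L100 _ => [l|l|].
- exact/valuation_preim/v_val.
- by apply: second_order_supermodular_preim (v_sos l); apply: inl_inj.
- exact: greedy_pad.
Qed.

(* 0.5104 = 319 / 625 *)
Theorem theorem1p3 (R : realType) :
  319%:R / 625%:R <=
    greedy_competitive_ratio (fun N : finType => @second_order_supermodular R N).
Proof.
apply: lb_le_inf.
  pose v (_ : unit) (A : {set unit}) : R := #|A|%:R.
  pose alg : @online_rule unit unit := fun _ _ => tt.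
  exists (expected_welfare v alg / OPT v); exists unit, unit, v, alg; split => //.
  - move=> l; split; first exact: valuation_card.
    exact: second_order_supermodular_card.
  - apply: lt_le_trans (le_bigmax _ _ [ffun=> tt]).
    rewrite /welfare (bigD1 tt) //= ltr_wpDr ?sumr_ge0 // ltr0n.
    by apply/card_gt0P; exists tt; rewrite inE ffunE.
move=> _ [N [M [v [alg [v_ok v_greedy OPT_gt0 ->]]]]].
by rewrite ler_pdivlMr //; apply: greedy_expected_welfare_ge => // l; case: (v_ok l).
Qed.
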